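(* Consider the forward process $q(x_1,\dots,x_T\mid x_0,c)=\prod_{t=1}^T q(x_t\mid x_{t-1},x_0,c)$ whose transition kernels are, for $t=1,\dots,T$, $$q(x_t\mid x_{t-1},x_0,c)=\mathcal N\big(x_t;\ \sqrt{\alpha_t}\,x_{t-1}+k_t r_\phi(x_0,c,t)-\sqrt{\alpha_t}\,k_{t-1}r_\phi(x_0,c,t-1),\ \beta_t I\big).$$ Then for every $t=1,\dots,T$ the conditional distribution of $x_t$ given $(x_0,c)$ is $$q(x_t\mid x_0,c)=\mathcal N\big(x_t;\ \sqrt{\bar\alpha_t}\,x_0+k_t r_\phi(x_0,c,t),\ (1-\bar\alpha_t)I\big).$$
   Context: $T\ge 1$ is an integer; $x_0,x_1,\dots,x_T\in\mathbb R^d$; $c$ is a condition taking values in some set $\mathcal C$. Noise schedule: $\alpha_t\in(0,1)$ for $t=1,\dots,T$, $\beta_t=1-\alpha_t$, $\bar\alpha_t=\prod_{s=1}^t\alpha_s$, with $\bar\alpha_0=1$. $r_\phi:\mathbb R^d\times\mathcal C\times\{0,1,\dots,T\}\to\mathbb R^d$ is a (measurable) function, called the relational network, and the scalars are $k_t=\sqrt{\bar\alpha_t}\,(1-\sqrt{\bar\alpha_t})$ (so $k_0=0$). $\mathcal N(x;\mu,\Sigma)$ denotes the Gaussian distribution in the variable $x$ with mean $\mu$ and covariance $\Sigma$; $I$ is the $d\times d$ identity matrix. *)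

(* Defs.v *)
From HB Require Import structures.
From mathcomp Require Import all_boot all_order all_algebra.
From mathcomp Require Import all_classical all_reals all_analysis.

Set Implicit Arguments.
Unset Strict Implicit.
Unset Printing Implicit Defensive.

Import Order.TTheory GRing.Theory Num.Theory.
Import numFieldNormedType.Exports.

Local Open Scope classical_set_scope.
Local Open Scope ring_scope.

Lemma sigma_finite_product d1 d2 (T1 : measurableType d1)
    (T2 : measurableType d2) (R : realType)
    (mu : {sigma_finite_measure set T1 -> \bar R})
    (nu : {sigma_finite_measure set T2 -> \bar R}) :
  sigma_finite setT (mu \x nu)%E.
Proof.
have /sigma_finiteP[F [TF ndF Foo]] := sigma_finiteT mu.
have /sigma_finiteP[G [TG ndG Goo]] := sigma_finiteT nu.
exists (fun n => F n `*` G n).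
  rewrite -setXTT TF TG predeqE => -[x y]; split.
    move=> [/= [n _ Fnx] [k _ Gky]]; exists (maxn n k) => //; split.
    - by move: x Fnx; exact/subsetPset/ndF/leq_maxl.
    - by move: y Gky; exact/subsetPset/ndG/leq_maxr.
  by move=> [n _ []/= ? ?]; split; exists n.
move=> k; have [? ?] := Foo k; have [? ?] := Goo k.
split; first exact: measurableX.
by rewrite product_measure1E// lte_mul_pinfty// ge0_fin_numE.
Qed.

Lemma sigma_finite_pushforward d1 d2 (T1 : measurableType d1)
    (T2 : measurableType d2) (R : realType)
    (mu : set T1 -> \bar R) (f : T1 -> T2) (g : T2 -> T1) :
  measurable_fun setT g -> cancel f g ->
  sigma_finite setT mu -> sigma_finite setT (pushforward mu f).
Proof.
move=> mg fK [F FT mF].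
exists (fun i => g @^-1` F i); first by rewrite -preimage_bigcup -FT.
move=> i; have [mFi Foo] := mF i; split.
  by rewrite -[X in measurable X]setTI; exact: mg.
rewrite /pushforward (_ : f @^-1` _ = F i)//.
by apply/seteqP; split=> x /=; rewrite fK.
Qed.

Section cons_measure.
Context d (T : measurableType d) (R : realType) (n : nat).
Variables (mu : {sigma_finite_measure set T -> \bar R})
  (nu : {sigma_finite_measure set (n.-tuple T) -> \bar R}).

Definition cons_pair (p : T * n.-tuple T) : n.+1.-tuple T :=
  [tuple of p.1 :: p.2].

Lemma measurable_cons_pair : measurable_fun setT cons_pair.
Proof. exact: (measurable_cons measurable_fst measurable_snd). Qed.

Definition cons_measure : set (n.+1.-tuple T) -> \bar R :=
  pushforward (mu \x nu)%E cons_pair.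

Let cons_measure0 : cons_measure set0 = 0%E.
Proof. by rewrite /cons_measure /pushforward preimage_set0 measure0. Qed.

Let cons_measure_ge0 A : (0 <= cons_measure A)%E.
Proof. exact: (measure_ge0 (mu \x nu)%E). Qed.

Let cons_measure_sigma_additive : semi_sigma_additive cons_measure.
Proof.
exact: (@measure_semi_sigma_additive _ _ _
  (measure_function_pushforward__canonical__measure_function_Measure
     (mu \x nu)%E measurable_cons_pair)).
Qed.

HB.instance Definition _ := isMeasure.Build _ _ _ cons_measure
  cons_measure0 cons_measure_ge0 cons_measure_sigma_additive.

Let cons_measure_sigma_finite : sigma_finite setT cons_measure.
Proof.
apply: (@sigma_finite_pushforward _ _ _ _ _ (mu \x nu)%E cons_pair
  (fun t : n.+1.-tuple T => (thead t, [tuple of behead t]))); last first.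
- exact: sigma_finite_product.
- by move=> [x t]; congr pair; apply/val_inj.
- apply/measurable_fun_pairP; split; first exact: measurable_tnth.
  exact: measurable_behead.
Qed.

HB.instance Definition _ := Measure_isSigmaFinite.Build _ _ _ cons_measure
  cons_measure_sigma_finite.

End cons_measure.

Fixpoint power_measure d (T : measurableType d) (R : realType)
    (mu : {sigma_finite_measure set T -> \bar R}) (n : nat) :
    {sigma_finite_measure set (n.-tuple T) -> \bar R} :=
  match n with
  | 0 => \d_([tuple] : 0.-tuple T)
  | n'.+1 => cons_measure mu (power_measure mu n')
  end.

Section measurable_cV.
Context d (T : measurableType d) (n : nat).

(* generated by the coordinates: the Borel sets of R^n when T is R *)
Let coors : 'I_n -> 'cV[T]_n -> T := fun i x => x i ord0.

HB.instance Definition _ := @isMeasurable.Build (measure_tuple_display d)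
  'cV[T]_n (g_sigma_preimage coors) (@sigma_algebra0 _ _ _)
  (@sigma_algebraC _ _) (@sigma_algebra_bigcup _ _ _).

End measurable_cV.

Lemma measurable_coord_cV d (T : measurableType d) n (i : 'I_n) :
  measurable_fun setT (fun x : 'cV[T]_n => x i ord0).
Proof.
move=> _ Y mY; rewrite setTI; apply: sub_sigma_algebra => /=.
rewrite -bigcup_seq/=; exists i => /=; first by rewrite mem_index_enum.
by exists Y => //; rewrite setTI.
Qed.

Lemma measurable_fun_cVP d1 d2 (T1 : measurableType d1)
    (T2 : measurableType d2) n (f : T1 -> 'cV[T2]_n) :
  measurable_fun setT f <->
  forall i, measurable_fun setT (fun x => f x i ord0).
Proof.
split=> [mf i|mf].
  exact: (measurableT_comp (measurable_coord_cV i) mf).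
apply: (@measurability _ _ _ _ _ _ (\big[setU/set0]_(i < n)
  preimage_set_system setT (fun x : 'cV[T2]_n => x i ord0) measurable)) => //.
move=> _ [B + <-]; rewrite -bigcup_seq/= => -[i _ [A mA <-]].
by rewrite !setTI -[X in measurable X]setTI; exact: mf.
Qed.

Section lebesgue_cV.
Context (R : realType) (n : nat).

Let lebesgue_tuple := power_measure (@lebesgue_measure R) n.

Definition col_of_tuple (x : n.-tuple (measurableTypeR R)) : 'cV[R]_n :=
  \col_i tnth x i.

Lemma measurable_col_of_tuple : measurable_fun setT col_of_tuple.
Proof.
apply/measurable_fun_cVP => i.
rewrite (_ : (fun _ => _) = (fun x => tnth x i)); first exact: measurable_tnth.
by apply/funext => x; rewrite mxE.
Qed.

Definition lebesgue_cV : set 'cV[R]_n -> \bar R :=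
  pushforward lebesgue_tuple col_of_tuple.

Let lebesgue_cV0 : lebesgue_cV set0 = 0%E.
Proof. by rewrite /lebesgue_cV /pushforward preimage_set0 measure0. Qed.

Let lebesgue_cV_ge0 A : (0 <= lebesgue_cV A)%E.
Proof. exact: (measure_ge0 lebesgue_tuple). Qed.

Let lebesgue_cV_sigma_additive : semi_sigma_additive lebesgue_cV.
Proof.
exact: (@measure_semi_sigma_additive _ _ _
  (measure_function_pushforward__canonical__measure_function_Measure
     lebesgue_tuple measurable_col_of_tuple)).
Qed.

HB.instance Definition _ := isMeasure.Build _ _ _ lebesgue_cV
  lebesgue_cV0 lebesgue_cV_ge0 lebesgue_cV_sigma_additive.

Let lebesgue_cV_sigma_finite : sigma_finite setT lebesgue_cV.
Proof.
apply: (@sigma_finite_pushforward _ _ _ _ _ lebesgue_tuple col_of_tuple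
  (fun x => [tuple x i ord0 | i < n])); last exact: sigma_finiteT.
- apply/measurable_fun_tnthP => i.
  rewrite (_ : _ \o _ = (fun x : 'cV[R]_n => x i ord0)).
    exact: measurable_coord_cV.
  by apply/funext => x /=; rewrite tnth_mktuple.
- by move=> x; apply: eq_from_tnth => i; rewrite tnth_mktuple mxE.
Qed.

HB.instance Definition _ := Measure_isSigmaFinite.Build _ _ _ lebesgue_cV
  lebesgue_cV_sigma_finite.

End lebesgue_cV.

Section gaussian.
Context (R : realType) (n : nat).
Implicit Types (mu x : 'cV[R]_n) (Sigma : 'M[R]_n).

(* meant for Sigma symmetric positive definite *)
Definition gaussian_pdf mu Sigma x : R :=
  (Num.sqrt ((2 * pi) ^+ n * \det Sigma))^-1 *
  expR (- ((x - mu)^T *m invmx Sigma *m (x - mu)) ord0 ord0 / 2).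

Definition gaussian mu Sigma (A : set 'cV[R]_n) : \bar R :=
  (\int[@lebesgue_cV R n]_(x in A) (gaussian_pdf mu Sigma x)%:E)%E.

End gaussian.

Section forward_process.
Context (R : realType) (C : Type) (T d : nat).
(* only alpha_1, ..., alpha_T and r(-, -, 0), ..., r(-, -, T) are used *)
Variables (alpha : nat -> R) (r : 'cV[R]_d -> C -> nat -> 'cV[R]_d).

Definition alpha_bar (t : nat) : R := \prod_(1 <= s < t.+1) alpha s.

Definition beta (t : nat) : R := 1 - alpha t.

Definition relation_coef (t : nat) : R :=
  Num.sqrt (alpha_bar t) * (1 - Num.sqrt (alpha_bar t)).

Local Notation k := relation_coef.

(* density at x of q(x_t | x_(t-1) = y, x_0, c) *)
Definition transition_pdf (x0 : 'cV[R]_d) (c : C) (t : nat)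
    (y x : 'cV[R]_d) : R :=
  gaussian_pdf
    (Num.sqrt (alpha t) *: y + k t *: r x0 c t
      - (Num.sqrt (alpha t) * k t.-1) *: r x0 c t.-1)
    ((beta t)%:M) x.

(* x_t, for a path x = (x_1, ..., x_T) started at x_0 *)
Definition state (x0 : 'cV[R]_d) (t : nat) (x : T.-tuple 'cV[R]_d) : 'cV[R]_d :=
  nth x0 (x0 :: x) t.

Definition forward_pdf (x0 : 'cV[R]_d) (c : C) (x : T.-tuple 'cV[R]_d) : R :=
  \prod_(1 <= t < T.+1) transition_pdf x0 c t (state x0 t.-1 x) (state x0 t x).

(* the law q(x_1, ..., x_T | x_0, c) *)
Definition forward_law (x0 : 'cV[R]_d) (c : C)
    (A : set (T.-tuple 'cV[R]_d)) : \bar R :=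
  (\int[power_measure (@lebesgue_cV R d) T]_(x in A)
     (forward_pdf x0 c x)%:E)%E.

(* the law q(x_t | x_0, c), meant for t >= 1 *)
Definition forward_marginal (x0 : 'cV[R]_d) (c : C) (t : nat) :
    set 'cV[R]_d -> \bar R :=
  pushforward (forward_law x0 c) (state x0 t).

End forward_process.

(* Main.v *)
(* By Tonelli, applied coordinate by coordinate, E[f(x_t) | x_0] is obtained by
   applying the first t transition operators to f. If q(x_t | x_0) is the
   Gaussian of mean sqrt(abar_t) x_0 + k_t r_t and variance 1 - abar_t, then
   x_(t+1) is an affine function of x_t plus independent Gaussian noise: the
   drift - sqrt(alpha_(t+1)) k_t r_t cancels the shift inherited from x_t, and
   the variances add up to
   alpha_(t+1) (1 - abar_t) + 1 - alpha_(t+1) = 1 - abar_(t+1). *)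
Require Import Defs.
From mathcomp Require Import all_boot all_order all_algebra.
From mathcomp Require Import all_classical all_reals all_analysis.
From mathcomp Require Import measurable_realfun ring.
Import Order.TTheory GRing.Theory Num.Theory.
Local Open Scope classical_set_scope.
Local Open Scope ring_scope.

(** * Integration against finite powers of a sigma-finite measure *)

Section power_measure_integral.
Context {d} {X : measurableType d} {R : realType}.
Variable mu : {sigma_finite_measure set X -> \bar R}.
Local Open Scope ereal_scope.

Lemma ge0_integral_power_measureS n (f : n.+1.-tuple X -> \bar R) :
  measurable_fun setT f -> (forall x, 0 <= f x) ->
  \int[power_measure mu n.+1]_x f x =
  \int[mu]_y \int[power_measure mu n]_x f (cons_pair (y, x)).
Proof.
move=> mf f0.
have mc := @measurable_cons_pair _ X n.
transitivity (\int[mu \x power_measure mu n]_p f (cons_pair p)).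
  exact: (ge0_integral_pushforward mc (mu \x power_measure mu n)%E
    measurableT mf (fun x _ => f0 x)).
rewrite (fubini_tonelli1 (f \o (@cons_pair _ X n)))//=.
exact: measurableT_comp.
Qed.

Lemma integral_power_measure0 (f : 0.-tuple X -> \bar R) :
  measurable_fun setT f -> \int[power_measure mu 0]_x f x = f [tuple].
Proof. by move=> mf; rewrite /= integral_dirac// diracT mul1e. Qed.

(** By Tonelli the head factor leaves the inner integral, which is 1 by induction. This normalizes
    the multivariate Gaussian once it is split into coordinates. *)
Lemma integral_power_measure_prod n (f : 'I_n -> X -> R) :
  (forall i, measurable_fun setT (f i)) -> (forall i x, (0 <= f i x)%R) ->
  (forall i, \int[mu]_x (f i x)%:E = 1) ->
  \int[power_measure mu n]_x (\prod_(i < n) f i (tnth x i))%:E = 1.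
Proof.
have mprod m (g : 'I_m -> X -> R) : (forall i, measurable_fun setT (g i)) ->
    measurable_fun setT
      (fun x : m.-tuple X => (\prod_(i < m) g i (tnth x i))%:E).
  move=> mg; apply/measurable_EFinP/measurable_prod => i _.
  by apply: measurableT_comp; [exact: mg | exact: measurable_tnth].
elim: n f => [|n IH] f mf f0 f1.
  by rewrite integral_power_measure0 ?big_ord0//; exact: mprod.
rewrite ge0_integral_power_measureS; last 2 first.
- exact: mprod.
- by move=> x; rewrite lee_fin prodr_ge0.
rewrite -(f1 ord0); apply: eq_integral => y _.
under eq_integral => x _.
  rewrite big_ord_recl EFinM (_ : tnth _ _ = y); last by rewrite (tnth_nth y).
  under eq_bigr => i _.
    rewrite (_ : tnth _ _ = tnth x i); last by rewrite !(tnth_nth y).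
    over.
  over.
rewrite ge0_integralZl_EFin//; last first.
- exact: (mprod n (fun i => f (lift ord0 i))).
- by move=> x _; rewrite lee_fin prodr_ge0.
by rewrite (IH (fun i => f (lift ord0 i)))// mule1.
Qed.

End power_measure_integral.

(** * Inhomogeneous Markov chains given by transition densities *)

Section markov_chain.
Context {d} {X : measurableType d} {R : realType}.
Variable mu : {sigma_finite_measure set X -> \bar R}.
Implicit Types (f : X -> \bar R) (p : X -> X -> R) (q : nat -> X -> X -> R).

Record transition_density p : Prop := TransitionDensity {
  transition_density_ge0 : forall y x, 0 <= p y x;
  measurable_transition_density :
    measurable_fun setT (fun z : X * X => p z.1 z.2);
  integral_transition_density : forall y, (\int[mu]_x (p y x)%:E = 1)%E }.

Definition transition_op p f (y : X) : \bar R :=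
  (\int[mu]_x ((p y x)%:E * f x))%E.

(** The last transition acts on [f] first: for transition densities the value at [y] is the
    expectation of [f] at time [t] for the chain started at [y]. *)
Fixpoint iter_transition q (t : nat) f : X -> \bar R :=
  if t is t'.+1 then iter_transition q t' (transition_op (q t) f) else f.

Definition path_density q n (y : X) (x : n.-tuple X) : R :=
  \prod_(1 <= t < n.+1) q t (nth y (y :: x) t.-1) (nth y (y :: x) t).

(** The definition peels off the last transition, which suits induction on time; integrating a path
    coordinate by coordinate peels off the first one, and this lemma links the two. *)
Lemma iter_transitionS q t f :
  iter_transition q t.+1 f =
  transition_op (q 1%N) (iter_transition (q \o succn) t f).
Proof. by elim: t f => // t IH f; rewrite [LHS]/= -IH. Qed.

Lemma transition_op_ge0 p f :
  transition_density p -> (forall x, 0 <= f x)%E ->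
  forall y, (0 <= transition_op p f y)%E.
Proof.
move=> [p0 _ _] f0 y; apply: integral_ge0 => x _.
by rewrite mule_ge0// lee_fin.
Qed.

Lemma measurable_transition_op p f :
  transition_density p -> (forall x, 0 <= f x)%E ->
  measurable_fun setT f -> measurable_fun setT (transition_op p f).
Proof.
move=> [p0 mp _] f0 mf.
apply: (measurable_fun_fubini_tonelli_F
  (fun z : X * X => (p z.1 z.2)%:E * f z.2)%E) => /=.
- apply: emeasurable_funM; first exact/measurable_EFinP.
  exact: measurableT_comp.
- by move=> z; rewrite mule_ge0// lee_fin.
Qed.

Lemma measurable_nth_path n t : (t <= n)%N ->
  measurable_fun setT (fun z : X * n.-tuple X => nth z.1 (z.1 :: z.2) t).
Proof.
case: t => [_|t tn]; first exact: measurable_fst.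
rewrite (_ : (fun _ => _) = (fun z => tnth z.2 (Ordinal tn))).
  exact: (measurableT_comp (measurable_tnth _) measurable_snd).
by apply/funext => z; rewrite (tnth_nth z.1).
Qed.

Lemma measurable_path_density q n :
  (forall t, (1 <= t <= n)%N -> transition_density (q t)) ->
  measurable_fun setT (fun z : X * n.-tuple X => path_density q n z.1 z.2).
Proof.
move=> qP; apply: measurable_prod => t; rewrite mem_index_iota => /andP[t1 tn].
have mq := measurable_transition_density _ (qP t (introT andP (conj t1 tn))).
apply: (measurableT_comp (f := fun z : X * X => q t z.1 z.2)
  (g := fun z : X * n.-tuple X =>
     (nth z.1 (z.1 :: z.2) t.-1, nth z.1 (z.1 :: z.2) t))) => //.
apply: measurable_fun_pair; apply: measurable_nth_path => //.
exact: leq_trans (leq_pred t) tn.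
Qed.

Lemma path_density_ge0 q n y x :
  (forall t, (1 <= t <= n)%N -> transition_density (q t)) ->
  0 <= path_density q n y x.
Proof.
move=> qP; rewrite /path_density big_seq prodr_ge0// => t.
by rewrite mem_index_iota => tn; apply: transition_density_ge0; exact: qP.
Qed.

Lemma path_density_cons q n (y z : X) (x : n.-tuple X) :
  path_density q n.+1 y (cons_pair (z, x)) =
  q 1%N y z * path_density (q \o succn) n z x.
Proof.
rewrite /path_density big_ltn// big_add1/=; congr (_ * _).
rewrite big_seq [RHS]big_seq; apply: eq_bigr => t.
rewrite mem_index_iota => /andP[t1 tn].
(* All indices are in range, so the defaults [y] and [z] of [nth] are interchangeable. *)
rewrite -(prednK t1)/= (set_nth_default z)//= ?(prednK t1)// 1?ltnW//.
  by rewrite (set_nth_default z)//= size_tuple -ltnS prednK.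
by rewrite size_tuple.
Qed.

(** Induction on the path length: the first coordinate [z] becomes the starting point of the chain
    shifted by [succn]. Transitions after time [t] integrate to 1 and disappear. *)
Lemma integral_path_density q n y t f :
  (forall s, (1 <= s <= n)%N -> transition_density (q s)) -> (t <= n)%N ->
  (forall x, 0 <= f x)%E -> measurable_fun setT f ->
  (\int[power_measure mu n]_x
     ((path_density q n y x)%:E * f (nth y (y :: x) t)) =
   iter_transition q t f y)%E.
Proof.
(* Stated for an arbitrary chain, since the induction step also needs it for the shifted one.
   Measurability in the path is obtained as a section, at [y'], of joint measurability. *)
have mint n' q' y' t' (f' : X -> \bar R) :
    (forall s, (1 <= s <= n')%N -> transition_density (q' s)) -> (t' <= n')%N ->
    measurable_fun setT f' ->
    measurable_fun setT (fun x : n'.-tuple X =>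
      ((path_density q' n' y' x)%:E * f' (nth y' (y' :: x) t'))%E).
  move=> q'P t'n' mf'.
  apply: (measurableT_comp (f := fun z : X * n'.-tuple X =>
    ((path_density q' n' z.1 z.2)%:E * f' (nth z.1 (z.1 :: z.2) t'))%E)
    (g := pair y')); last exact: pair1_measurable.
  apply: emeasurable_funM.
    by apply/measurable_EFinP; exact: measurable_path_density.
  by apply: measurableT_comp => //; exact: measurable_nth_path.
elim: n q y t f => [|n IH] q y t f qP tn f0 mf.
  rewrite integral_power_measure0; last exact: mint.
  move: tn; rewrite leqn0 => /eqP->.
  by rewrite /path_density big_geq// mul1e.
have qSP s : (1 <= s <= n)%N -> transition_density ((q \o succn) s).
  by move=> /andP[_ sn]; apply: qP.
have q1P : transition_density (q 1%N) by exact: qP.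
rewrite ge0_integral_power_measureS; last 2 first.
- exact: mint.
- by move=> x; rewrite mule_ge0// lee_fin; exact: path_density_ge0.
under eq_integral => z _.
  under eq_integral => x _.
    rewrite path_density_cons EFinM -muleA.
    (* For positive [t], time [t] is time [t.-1] of the shifted chain. For [t = 0] the test function
       is the constant [f y], evaluated at time [0.-1 = 0], so the induction hypothesis covers both
       cases. *)
    rewrite (_ : f _ =
        (if t is t'.+1 then f else cst (f y)) (nth z (z :: x) t.-1));
      last first.
      case: t tn => // t tn /=.
      by rewrite (set_nth_default z)//= size_tuple ltnS.
    over.
  rewrite ge0_integralZl_EFin//; last 3 first.
  - move=> x _; apply: mule_ge0.
      by rewrite lee_fin; exact: path_density_ge0.
    by case: (t) => [|s] /=.
  - apply: (mint n (q \o succn)) => //; first by case: (t) tn.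
    by case: (t) => //; exact: measurable_cst.
  - exact: transition_density_ge0.
  rewrite IH//; last 3 first.
  - by case: (t) tn.
  - by move=> x; case: (t) => [|s] /=.
  - by case: (t) => //; exact: measurable_cst.
  over.
(* In the case [t = 0] the constant [f y] comes out and the density [q 1 y] integrates to 1. *)
case: t tn => [_|t tn]; last by rewrite iter_transitionS.
rewrite /= ge0_integralZr//=; last 2 first.
- have mq := measurable_transition_density _ q1P.
  by apply/measurable_EFinP; exact: measurable_fun_pair2 mq.
- by move=> x _; rewrite lee_fin; exact: transition_density_ge0.
by rewrite integral_transition_density// mul1e.
Qed.

(** Chapman-Kolmogorov, by Tonelli: [h] is the two-step density from the fixed point [y]. *)
Lemma transition_op_comp p1 p2 (h : X -> R) f y :
  transition_density p1 -> transition_density p2 ->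
  (forall z, 0 <= h z) ->
  measurable_fun setT f -> (forall x, 0 <= f x)%E ->
  (forall z, (\int[mu]_x (p1 y x * p2 x z)%:E)%E = (h z)%:E) ->
  transition_op p1 (transition_op p2 f) y =
  (\int[mu]_z ((h z)%:E * f z))%E.
Proof.
move=> [p10 mp1 p11] [p20 mp2 p21] h0 mf f0 hE.
have mp1y : measurable_fun setT (p1 y) by exact: measurable_fun_pair2 mp1.
transitivity (\int[mu]_x \int[mu]_z ((p1 y x * p2 x z)%:E * f z))%E.
  apply: eq_integral => x _.
  rewrite /transition_op -ge0_integralZl_EFin//.
  - by apply: eq_integral => z _; rewrite muleA EFinM.
  - by move=> z _; rewrite mule_ge0// lee_fin.
  - apply: emeasurable_funM => //; apply/measurable_EFinP.
    exact: measurable_fun_pair2 mp2.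
rewrite (fubini_tonelli
  (fun u : X * X => ((p1 y u.1 * p2 u.1 u.2)%:E * f u.2)%E))//=.
- apply: eq_integral => z _; rewrite -hE ge0_integralZr//.
  + apply/measurable_EFinP/measurable_funM => //.
    exact: measurable_fun_pair1 mp2.
  + by move=> x _; rewrite lee_fin mulr_ge0.
- apply: emeasurable_funM; last exact: measurableT_comp.
  apply/measurable_EFinP/measurable_funM => //.
  exact: measurableT_comp.
- by move=> u; rewrite mule_ge0// lee_fin mulr_ge0.
Qed.

End markov_chain.

(** * Gaussians with scalar covariance and their convolution *)

Section isotropic_gaussian.
Context {R : realType}.

Lemma normal_pdf_sqrtE (m s x : R) : 0 < s ->
  normal_pdf m (Num.sqrt s) x =
  (Num.sqrt (2 * pi * s))^-1 * expR (- ((x - m) ^+ 2 / s) / 2).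
Proof.
move=> s0; rewrite normal_pdfE; last by rewrite gt_eqF// sqrtr_gt0.
rewrite /normal_peak /normal_fun sqr_sqrtr ?ltW//; congr (_^-1 * expR _).
  by congr (Num.sqrt _); ring.
by rewrite -[s *+ 2]mulr_natr invfM mulrA mulNr.
Qed.

(* Completing the square in y: the right-hand side is the law of
   x = a y + b + noise times the posterior law of y given x. *)
Lemma normal_pdf_bayes (a b m s v x y : R) : 0 < s -> 0 < v ->
  let w := a ^+ 2 * s + v in
  normal_pdf m (Num.sqrt s) y * normal_pdf (a * y + b) (Num.sqrt v) x =
  normal_pdf (a * m + b) (Num.sqrt w) x *
  normal_pdf ((v * m + a * s * (x - b)) / w) (Num.sqrt (s * v / w)) y.
Proof.
move=> s0 v0 w.
have w0 : 0 < w by rewrite ltr_wpDl// mulr_ge0 ?sqr_ge0// ltW.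
have pi0 : 0 < 2 * pi :> R by rewrite mulr_gt0// pi_gt0.
rewrite !normal_pdf_sqrtE ?divr_gt0 ?mulr_gt0//.
rewrite mulrACA [RHS]mulrACA -!expRD -!invfM -!sqrtrM ?mulr_ge0 ?pi_ge0 1?ltW//.
congr ((Num.sqrt _)^-1 * expR _).
  by field; rewrite gt_eqF.
by rewrite /w; field; rewrite !gt_eqF.
Qed.

Context {d : nat}.
Implicit Types m b x y : 'cV[R]_d.

(** A scalar covariance has determinant [s ^+ d] and inverse [s^-1%:M], so the coordinates are
    independent. This reduces the vector statements to dimension one. *)
Lemma gaussian_pdf_scalarE m (s : R) x : 0 < s ->
  gaussian_pdf m s%:M x =
  \prod_(i < d) normal_pdf (m i ord0) (Num.sqrt s) (x i ord0).
Proof.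
move=> s0; under eq_bigr do rewrite normal_pdf_sqrtE//.
rewrite big_split/= -expR_sum /gaussian_pdf; congr (_ * expR _).
  rewrite prodr_const card_ord det_scalar -exprMn.
  rewrite exprVn; congr (_^-1).
  by elim: (d) => [|n IH]; rewrite ?expr0 ?sqrtr1// !exprS sqrtrM ?IH//
    ?mulr_ge0 ?pi_ge0// ltW.
rewrite -mulr_suml sumrN invmx_scalar mul_mx_scalar -scalemxAl !mxE mulr_sumr.
by congr (- _ / _); apply: eq_bigr => i _; rewrite !mxE expr2 mulrC.
Qed.

Lemma gaussian_pdf_scalar_ge0 m (s : R) x : 0 < s ->
  0 <= gaussian_pdf m s%:M x.
Proof.
move=> s0; rewrite gaussian_pdf_scalarE// prodr_ge0// => i _.
exact: normal_pdf_ge0.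
Qed.

Lemma gaussian_pdf_bayes (a s v : R) b m x y : 0 < s -> 0 < v ->
  let w := a ^+ 2 * s + v in
  gaussian_pdf m s%:M y * gaussian_pdf (a *: y + b) v%:M x =
  gaussian_pdf (a *: m + b) w%:M x *
  gaussian_pdf (w^-1 *: (v *: m + (a * s) *: (x - b))) (s * v / w)%:M y.
Proof.
move=> s0 v0 w.
have w0 : 0 < w by rewrite ltr_wpDl// mulr_ge0 ?sqr_ge0// ltW.
rewrite !gaussian_pdf_scalarE ?divr_gt0 ?mulr_gt0// -!big_split/=.
apply: eq_bigr => i _; rewrite !mxE.
by rewrite [w^-1 * _]mulrC normal_pdf_bayes.
Qed.

(** Joint measurability in mean and point follows from translation invariance: the value is that of
    the centred density at the difference. *)
Lemma measurable_normal_pdf_mean (s : R) : 0 < s ->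
  measurable_fun setT (fun z : R * R => normal_pdf z.1 (Num.sqrt s) z.2).
Proof.
move=> s0.
rewrite (_ : (fun _ => _) = normal_pdf 0 (Num.sqrt s) \o (fun z => z.2 - z.1)).
  apply: measurableT_comp; first exact: measurable_normal_pdf.
  exact: measurable_funB.
by apply/funext => z /=; rewrite !normal_pdf_sqrtE// subr0.
Qed.

Lemma measurable_gaussian_pdf_mean d1 (Y : measurableType d1)
    (mean : Y -> 'cV[R]_d) (s : R) :
  0 < s -> measurable_fun setT mean ->
  measurable_fun setT
    (fun z : Y * 'cV[R]_d => gaussian_pdf (mean z.1) s%:M z.2).
Proof.
move=> s0 /measurable_fun_cVP mmean.
under eq_fun do rewrite gaussian_pdf_scalarE//.
apply: measurable_prod => i _.
apply: (measurableT_comp (measurable_normal_pdf_mean s s0)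
  (g := fun z : Y * 'cV[R]_d => (mean z.1 i ord0, z.2 i ord0))).
apply: measurable_fun_pair.
  exact: measurableT_comp (mmean i) measurable_fst.
exact: measurableT_comp (measurable_coord_cV i) measurable_snd.
Qed.

Lemma measurable_gaussian_pdf m (s : R) :
  0 < s -> measurable_fun setT (gaussian_pdf m s%:M).
Proof.
move=> s0; rewrite (_ : gaussian_pdf _ _ = fun x =>
  \prod_(i < d) normal_pdf (m i ord0) (Num.sqrt s) (x i ord0)).
  apply: measurable_prod => i _.
  exact: measurableT_comp (measurable_normal_pdf _ _) (measurable_coord_cV i).
by apply/funext => x; rewrite gaussian_pdf_scalarE.
Qed.

Lemma integral_gaussian_pdf_scalar m (s : R) : 0 < s ->
  (\int[@lebesgue_cV R d]_x (gaussian_pdf m s%:M x)%:E = 1)%E.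
Proof.
move=> s0.
have mg : measurable_fun setT (fun x => (gaussian_pdf m s%:M x)%:E).
  by apply/measurable_EFinP; exact: measurable_gaussian_pdf.
rewrite (ge0_integral_pushforward (@measurable_col_of_tuple R d)
  (power_measure (@lebesgue_measure R) d) measurableT mg); last first.
  by move=> x _; rewrite lee_fin gaussian_pdf_scalar_ge0.
rewrite preimage_setT -[RHS](integral_power_measure_prod (@lebesgue_measure R) d
  (fun i => normal_pdf (m i ord0) (Num.sqrt s))).
- apply: eq_integral => x _ /=; rewrite gaussian_pdf_scalarE//.
  by congr EFin; apply: eq_bigr => i _; rewrite mxE.
- by move=> i; exact: measurable_normal_pdf.
- by move=> i x; exact: normal_pdf_ge0.
- by move=> i; exact: integral_normal_pdf.
Qed.

Lemma gaussian_transition_density (mean : 'cV[R]_d -> 'cV[R]_d) (s : R) :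
  0 < s -> measurable_fun setT mean ->
  transition_density (@lebesgue_cV R d)
    (fun y x => gaussian_pdf (mean y) s%:M x).
Proof.
move=> s0 mmean; split.
- by move=> y x; exact: gaussian_pdf_scalar_ge0.
- exact: measurable_gaussian_pdf_mean.
- by move=> y; exact: integral_gaussian_pdf_scalar.
Qed.

Lemma measurable_affine_cV (a : R) b :
  measurable_fun setT (fun y : 'cV[R]_d => a *: y + b).
Proof.
apply/measurable_fun_cVP => i; under eq_fun do rewrite !mxE.
by apply: measurable_funD => //; apply: measurable_funM => //;
  exact: measurable_coord_cV.
Qed.

(** After the Bayes factorization one factor is free of [y] and comes out; the other is the
    posterior density in [y], of integral 1. *)
Lemma gaussian_pdf_convolution (a s v : R) m b x : 0 < s -> 0 < v ->
  (\int[@lebesgue_cV R d]_y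
    (gaussian_pdf m s%:M y * gaussian_pdf (a *: y + b) v%:M x)%:E)%E =
  (gaussian_pdf (a *: m + b) (a ^+ 2 * s + v)%:M x)%:E.
Proof.
move=> s0 v0; have w0 : 0 < a ^+ 2 * s + v.
  by rewrite ltr_wpDl// mulr_ge0 ?sqr_ge0// ltW.
have u0 : 0 < s * v / (a ^+ 2 * s + v) by rewrite divr_gt0 ?mulr_gt0.
under eq_integral do rewrite gaussian_pdf_bayes// EFinM.
rewrite ge0_integralZl_EFin//.
- by rewrite integral_gaussian_pdf_scalar// mule1.
- by move=> y _; rewrite lee_fin gaussian_pdf_scalar_ge0.
- by apply/measurable_EFinP; exact: measurable_gaussian_pdf.
- exact: gaussian_pdf_scalar_ge0.
Qed.

End isotropic_gaussian.

(** * The noise schedule and the marginals of the forward process *)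

Section diffusion.
Context {R : realType} {C : Type} {d : nat}.
Variables (alpha : nat -> R) (r : 'cV[R]_d -> C -> nat -> 'cV[R]_d).
Variables (x0 : 'cV[R]_d) (c : C) (T : nat).
Hypothesis alpha01 : forall t : nat, (1 <= t <= T)%N -> 0 < alpha t < 1.

Local Notation abar := (alpha_bar alpha).
Local Notation k := (relation_coef alpha).
Local Notation q := (transition_pdf alpha r x0 c).

Lemma alpha_bar0 : abar 0 = 1.
Proof. by rewrite /alpha_bar big_geq. Qed.

Lemma alpha_barS t : abar t.+1 = abar t * alpha t.+1.
Proof. by rewrite /alpha_bar big_nat_recr. Qed.

Lemma relation_coef0 : k 0 = 0.
Proof. by rewrite /relation_coef alpha_bar0 sqrtr1 subrr mulr0. Qed.

Lemma alpha_bar_gt0 t : (t <= T)%N -> 0 < abar t.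
Proof.
elim: t => [_|t IH tT]; first by rewrite alpha_bar0.
rewrite alpha_barS mulr_gt0 ?IH 1?ltnW//.
by have /andP[] := alpha01 t.+1 tT.
Qed.

(** The product starts below 1 at time 1 and each further factor decreases it. This makes the
    marginal variance positive. *)
Lemma alpha_bar_lt1 t : (1 <= t <= T)%N -> abar t < 1.
Proof.
case: t => // t; elim: t => [|t IH] tT; have /andP[a0 a1] := alpha01 _ tT.
  by rewrite alpha_barS alpha_bar0 mul1r.
have tT' : (1 <= t.+1 <= T)%N by rewrite /= ltnW.
by rewrite alpha_barS (lt_trans _ (IH tT'))// gtr_pMr// alpha_bar_gt0.
Qed.

Lemma transition_pdf_density t : (1 <= t <= T)%N ->
  transition_density (@lebesgue_cV R d) (q t).
Proof.
move=> tT; apply: (gaussian_transition_density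
  (fun y => Num.sqrt (alpha t) *: y + k t *: r x0 c t
    - (Num.sqrt (alpha t) * k t.-1) *: r x0 c t.-1)).
  by rewrite subr_gt0; have /andP[] := alpha01 t tT.
under eq_fun do rewrite -addrA.
exact: measurable_affine_cV.
Qed.

(** The induction starts at time 1, because at time 0 the variance [1 - abar 0] vanishes and there
    is no density. *)
Lemma iter_transition_gaussian t (f : 'cV[R]_d -> \bar R) :
  (1 <= t <= T)%N -> measurable_fun setT f -> (forall x, 0 <= f x)%E ->
  iter_transition (@lebesgue_cV R d) q t f x0 =
  (\int[@lebesgue_cV R d]_x
     ((gaussian_pdf (Num.sqrt (abar t) *: x0 + k t *: r x0 c t)
        (1 - abar t)%:M x)%:E * f x))%E.
Proof.
case: t => // t; elim: t f => [|t IH] f tT mf f0.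
  (* At time 1 the term in [r x0 c 0] vanishes because [k 0 = 0]. *)
  rewrite /= /transition_op /transition_pdf /beta relation_coef0 mulr0 scale0r.
  by rewrite subr0 alpha_barS alpha_bar0 mul1r.
have t'T : (1 <= t.+1 <= T)%N by rewrite /= ltnW.
have qP := transition_pdf_density t.+2 tT.
have s0 : 0 < 1 - abar t.+1 by rewrite subr_gt0 alpha_bar_lt1.
have /andP[a0 a1] := alpha01 t.+2 tT.
have v0 : 0 < 1 - alpha t.+2 by rewrite subr_gt0.
rewrite [LHS]/=; rewrite [LHS]IH//; last 2 first.
- exact: measurable_transition_op.
- exact: transition_op_ge0.
set m := _ + _.
(* The marginal already found is viewed as a transition density that ignores its starting point, so
   that it can be composed with the next transition; the start [x0] given to [transition_op_comp] is
   then a dummy. *)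
have mP := gaussian_transition_density (cst m) _ s0 (measurable_cst m).
have g0 z : 0 <= gaussian_pdf (Num.sqrt (abar t.+2) *: x0 +
    k t.+2 *: r x0 c t.+2) (1 - abar t.+2)%:M z.
  by apply: gaussian_pdf_scalar_ge0; rewrite subr_gt0 alpha_bar_lt1.
apply: (transition_op_comp _ _ _ _ _ x0 mP qP g0 mf f0).
move=> z; rewrite /transition_pdf /beta.
under eq_integral do rewrite -addrA.
rewrite (gaussian_pdf_convolution _ _ _ _ _ _ s0 v0) (sqr_sqrtr (ltW a0)).
have -> : alpha t.+2 * (1 - abar t.+1) + (1 - alpha t.+2) = 1 - abar t.+2.
  by rewrite (alpha_barS t.+1); ring.
suff -> : Num.sqrt (alpha t.+2) *: m + (k t.+2 *: r x0 c t.+2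
      - (Num.sqrt (alpha t.+2) * k t.+1) *: r x0 c t.+1) =
    Num.sqrt (abar t.+2) *: x0 + k t.+2 *: r x0 c t.+2 by [].
have -> : Num.sqrt (abar t.+2) = Num.sqrt (alpha t.+2) * Num.sqrt (abar t.+1).
  by rewrite (alpha_barS t.+1) mulrC -sqrtrM// ltW.
by rewrite /m scalerDr !scalerA -addrA (addrC _ (_ - _)) subrK.
Qed.

End diffusion.

Theorem lemma1 (R : realType) (d T : nat) (C : Type)
  (alpha : nat -> R) (r : 'cV[R]_d -> C -> nat -> 'cV[R]_d)
  (T_ge1 : (1 <= T)%N)
  (alpha01 : forall t : nat, (1 <= t <= T)%N -> 0 < alpha t < 1)
  (r_measurable : forall (c : C) (t : nat), (t <= T)%N ->
    measurable_fun setT (fun x0 : 'cV[R]_d => r x0 c t))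
  (x0 : 'cV[R]_d) (c : C) (t : nat) (t1T : (1 <= t <= T)%N)
  (A : set 'cV[R]_d) (mA : measurable A) :
  forward_marginal T alpha r x0 c t A =
  gaussian (Num.sqrt (alpha_bar alpha t) *: x0
              + relation_coef alpha t *: r x0 c t)
    (1 - alpha_bar alpha t)%:M A.
Proof.
have tT : (t <= T)%N by case/andP: t1T.
(* Taking the indicator of [A] as test function turns both measures of [A] into integrals over the
   whole space. *)
have m1 : measurable_fun setT (fun x => (\1_A x : R)%:E).
  exact/measurable_EFinP/measurable_indic.
have p1 x : (0 <= (\1_A x : R)%:E)%E by rewrite lee_fin.
transitivity (iter_transition (@lebesgue_cV R d) (transition_pdf alpha r x0 c) t
  (fun x => (\1_A x)%:E) x0).
  (* [forward_pdf] is, by unfolding, the [path_density] of [transition_pdf] started at [x0]. *)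
  rewrite -(integral_path_density _ _ T)//; last first.
    by move=> s; exact: transition_pdf_density alpha01 s.
  rewrite /forward_marginal /pushforward /forward_law integral_mkcond.
  by apply: eq_integral => x _; rewrite epatch_indic.
rewrite (iter_transition_gaussian _ _ _ _ T)// /gaussian [RHS]integral_mkcond.
by apply: eq_integral => x _; rewrite epatch_indic.
Qed.
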